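(* For every ordinal $\alpha\ge 2$, none of the properties $\mathrm{DCR}_\alpha$, $\neg\mathrm{DCR}_\alpha$, $\mathrm{DCR}$, $\neg\mathrm{DCR}$ of abstract rewrite systems is a generalised first-order property.
   Context: An ARS is a pair $(A,\to)$, $A$ non-empty, ${\to}\subseteq A\times A$. It is DCR (decreasing Church–Rosser) if there is a well-founded partial order $(I,<)$ and relations $(\to_\gamma)_{\gamma\in I}$ on $A$ with $\bigcup_{\gamma\in I}{\to_\gamma}={\to}$ such that every peak $c\leftarrow_\beta a\rightarrow_\gamma b$ can be joined, for some $d$, by $b \twoheadrightarrow_{<\gamma} \cdot \rightarrow_\beta^{\equiv} \cdot \twoheadrightarrow_{<\gamma \cup <\beta} d$ and $c \twoheadrightarrow_{<\beta} \cdot \rightarrow_\gamma^{\equiv} \cdot \twoheadrightarrow_{<\gamma\cup<\beta} d$, where ${\to_{<\delta}}=\bigcup_{\epsilon<\delta}{\to_\epsilon}$, ${\to_{<\gamma\cup<\beta}}={\to_{<\gamma}}\cup{\to_{<\beta}}$, $\twoheadrightarrow_X$ is the reflexive transitive closure of $\to_X$, and $\to^{\equiv}_\delta$ is $\to_\delta$ union identity. For an ordinal $\alpha$, $\mathrm{DCR}_\alpha$ is the same with $I=\{\beta\mid\beta<\alpha\}$ and the usual ordinal order. $\neg P$ is the property of not having $P$. A property $P$ is a generalised first-order property if there is a set $\Phi$ of sentences of first-order logic with equality and a binary predicate symbol $\to$ (interpreted as the one-step relation) such that for every ARS $\mathcal{A}$, $\mathcal{A}$ has $P$ iff $\mathcal{A}\models\Phi$.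 *)

(* Defs.v *)
From Stdlib Require Import Relations RelationClasses Bool Arith.

Record ARS := mkARS {
  carrier :> Type;
  step : relation carrier;
  carrier_inhabited : inhabited carrier
}.

Section Decreasing.

Variables (A : Type) (I : Type) (lt : relation I) (R : I -> relation A).

Definition below (delta : I) : relation A :=
  fun x y => exists epsilon, lt epsilon delta /\ R epsilon x y.

(* b ->>_{<gamma} . ->^=_beta . ->>_{<gamma u <beta} d *)
Definition decreasing_leg (gamma beta : I) (b d : A) : Prop :=
  exists b1 b2,
    clos_refl_trans A (below gamma) b b1 /\
    clos_refl A (R beta) b1 b2 /\
    clos_refl_trans A (union A (below gamma) (below beta)) b2 d.

Definition locally_decreasing : Prop :=
  forall (beta gamma : I) (a b c : A),
    R beta a c -> R gamma a b ->
    exists d, decreasing_leg gamma beta b d /\ decreasing_leg beta gamma c d.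

End Decreasing.

Definition DCR_labelled (I : Type) (lt : relation I) (S : ARS) : Prop :=
  exists R : I -> relation S,
    (forall x y, step S x y <-> exists gamma, R gamma x y) /\
    locally_decreasing S I lt R.

Definition DCR (S : ARS) : Prop :=
  exists (I : Type) (lt : relation I),
    StrictOrder lt /\ well_founded lt /\ DCR_labelled I lt S.

(* An ordinal alpha is represented by a well-ordered type of order type alpha;
   its elements play the role of the ordinals beta < alpha. *)
Record Ord := mkOrdinal {
  ord_carrier :> Type;
  ord_rel : relation ord_carrier;
  ord_strict : StrictOrder ord_rel;
  ord_total : forall x y, ord_rel x y \/ x = y \/ ord_rel y x;
  ord_wf : well_founded ord_rel
}.

(* alpha <= beta: alpha is isomorphic to an initial segment of beta. *)
Definition ord_le (alpha beta : Ord) : Prop :=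
  exists f : alpha -> beta,
    (forall x y, ord_rel alpha x y -> ord_rel beta (f x) (f y)) /\
    (forall x z, ord_rel beta z (f x) -> exists y, z = f y).

Lemma bool_lt_wf : well_founded Bool.lt.
Proof.
  assert (H : Acc Bool.lt false).
  { constructor; intros [|] h; simpl in h; [contradiction | discriminate]. }
  intros [|]; [| exact H].
  constructor; intros [|] h; simpl in h; [contradiction | exact H].
Qed.

Lemma bool_lt_strict : StrictOrder Bool.lt.
Proof.
  split.
  - intros [|] h; simpl in h; [contradiction | discriminate].
  - intros [|] [|] [|]; simpl; auto.
Qed.

Lemma bool_lt_total (x y : bool) : Bool.lt x y \/ x = y \/ Bool.lt y x.
Proof. destruct x, y; simpl; auto. Qed.

Definition ord_two : Ord :=
  mkOrdinal bool Bool.lt bool_lt_strict bool_lt_total bool_lt_wf.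

Definition DCR_ord (alpha : Ord) (S : ARS) : Prop :=
  DCR_labelled alpha (ord_rel alpha) S.

Inductive formula : Set :=
| FEq (x y : nat)
| FStep (x y : nat)
| FBot
| FNot (phi : formula)
| FAnd (phi psi : formula)
| FOr (phi psi : formula)
| FImp (phi psi : formula)
| FAll (x : nat) (phi : formula)
| FEx (x : nat) (phi : formula).

Fixpoint free (z : nat) (phi : formula) : Prop :=
  match phi with
  | FEq x y | FStep x y => z = x \/ z = y
  | FBot => False
  | FNot phi => free z phi
  | FAnd phi psi | FOr phi psi | FImp phi psi => free z phi \/ free z psi
  | FAll x phi | FEx x phi => z <> x /\ free z phi
  end.

Definition sentence (phi : formula) : Prop := forall z, ~ free z phi.

Definition update (A : Type) (rho : nat -> A) (x : nat) (a : A) : nat -> A :=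
  fun z => if Nat.eqb z x then a else rho z.

Fixpoint sat (S : ARS) (rho : nat -> S) (phi : formula) : Prop :=
  match phi with
  | FEq x y => rho x = rho y
  | FStep x y => step S (rho x) (rho y)
  | FBot => False
  | FNot phi => ~ sat S rho phi
  | FAnd phi psi => sat S rho phi /\ sat S rho psi
  | FOr phi psi => sat S rho phi \/ sat S rho psi
  | FImp phi psi => sat S rho phi -> sat S rho psi
  | FAll x phi => forall a : S, sat S (update S rho x a) phi
  | FEx x phi => exists a : S, sat S (update S rho x a) phi
  end.

(* Valuations exist because carriers are inhabited, and the choice of valuation
   is irrelevant for sentences. *)
Definition models (S : ARS) (Phi : formula -> Prop) : Prop :=
  forall phi, Phi phi -> forall rho : nat -> S, sat S rho phi.

Definition neg_property (P : ARS -> Prop) : ARS -> Prop := fun S => ~ P S.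

Definition generalised_first_order (P : ARS -> Prop) : Prop :=
  exists Phi : formula -> Prop,
    (forall phi, Phi phi -> sentence phi) /\
    (forall S : ARS, P S <-> models S Phi).

(* Main.v *)
From mathcomp Require Import all_boot.
From mathcomp Require Import boolp classical_sets filter.
From Stdlib Require Import Relations.
Require Import Defs.

(** All four claims follow from one pair of elementarily equivalent systems, the
    first [DCR] with two labels, the second not even locally confluent.  The
    first, [countdown], has chains [n -> n-1 -> ... -> 0] and peaks
    [0 <- a_n -> n]: every peak is joinable, but by arbitrarily long reductions.
    The second is an ultrapower of it, in which the diagonal peak
    [0 <- [a_n] -> [n]] can only be joined by a reduction of infinite length. *)

Set Implicit Arguments.
Unset Strict Implicit.
Unset Printing Implicit Defensive.

Local Open Scope classical_set_scope.

(** * Ultrapowers and the theorem of Łoś *)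

Section Ultrapower.

Variables (I : Type) (U : set_system I) (S : ARS).
Hypothesis ultraU : UltraFilter U.

Lemma ultra_setC (A : set I) : U (~` A) <-> ~ U A.
Proof.
split=> [UnA UA | nUA].
  by have [i []] := filter_ex (filterI UA UnA).
by have [] := in_ultra_setVsetC A ultraU.
Qed.

Definition ae_eq (f g : I -> S) : Prop := U [set i | f i = g i].

Lemma ae_eq_refl f : ae_eq f f.
Proof. by apply: filterS (filterT (F := U)) => i. Qed.

Lemma ae_eq_sym f g : ae_eq f g -> ae_eq g f.
Proof. by apply: filterS => i /= ->. Qed.

Lemma ae_eq_trans f g h : ae_eq f g -> ae_eq g h -> ae_eq f h.
Proof. by move=> fg gh; apply: filterS (filterI fg gh) => i /= [-> ->]. Qed.

(* [xget] depends only on the set, so equivalent functions share one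
   representative; the set is never empty, so the default [x0] plays no role. *)
Definition ae_repr (x0 f : I -> S) : I -> S :=
  @xget {classic I -> S} x0 [set g | ae_eq g f].

Lemma ae_reprP x0 f : ae_eq (ae_repr x0 f) f.
Proof.
apply: (@xgetPex {classic I -> S} x0 [set g | ae_eq g f]).
by exists f; exact: ae_eq_refl.
Qed.

Lemma ae_repr_eq x0 f g : ae_repr x0 f = ae_repr x0 g <-> ae_eq f g.
Proof.
split=> [e | fg].
  apply: ae_eq_trans (ae_reprP x0 g).
  by rewrite -e; exact/ae_eq_sym/ae_reprP.
congr (@xget {classic I -> S} x0 _); apply/seteqP; split=> h /= hf.
  exact: ae_eq_trans fg.
exact: ae_eq_trans (ae_eq_sym fg).
Qed.

Variable s0 : S.

(** The quotient by [ae_eq], encoded by canonical representatives, so that equality of classes is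
    plain equality, as the semantics of [FEq] demands. *)
Definition ultra_carrier : Type := {f : I -> S | ae_repr (fun=> s0) f = f}.

Lemma ae_repr_id f :
  ae_repr (fun=> s0) (ae_repr (fun=> s0) f) = ae_repr (fun=> s0) f.
Proof. exact/ae_repr_eq/ae_reprP. Qed.

Definition ultra_class (f : I -> S) : ultra_carrier :=
  exist _ (ae_repr (fun=> s0) f) (ae_repr_id f).

Definition ultra_step (x y : ultra_carrier) : Prop :=
  U [set i | step S (sval x i) (sval y i)].

Definition ultrapower : ARS :=
  mkARS ultra_carrier ultra_step (inhabits (ultra_class (fun=> s0))).

Lemma ultra_classK (x : ultrapower) : ultra_class (sval x) = x.
Proof. by case: x => f ef; exact: eq_exist. Qed.

Lemma ultra_class_eq f g : ultra_class f = ultra_class g <-> ae_eq f g.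
Proof.
rewrite -(ae_repr_eq (fun=> s0)); split=> [/(congr1 sval) //|e].
exact: eq_exist.
Qed.

Lemma ultra_class_step f g :
  step ultrapower (ultra_class f) (ultra_class g) <->
  U [set i | step S (f i) (g i)].
Proof.
have rf := ae_reprP (fun=> s0) f; have rg := ae_reprP (fun=> s0) g.
split=> /= h; apply: filterS (filterI h (filterI rf rg)) => i /= [+ [ef eg]].
  by rewrite ef eg.
by rewrite ef eg.
Qed.

(** Induction on the formula: closure under intersection and supersets handles conjunction,
    maximality of [U] handles negation, and choice handles existential quantifiers. *)
Lemma los (rho : nat -> I -> S) (phi : formula) :
  sat ultrapower (fun z => ultra_class (rho z)) phi <->
  U [set i | sat S (rho^~ i) phi].
Proof.
have updE (r : nat -> I -> S) x f :
    update ultrapower (fun z => ultra_class (r z)) x (ultra_class f) =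
    fun z => ultra_class (update _ r x f z).
  by apply/funext => z; rewrite /update; case: Nat.eqb.
have updE' (r : nat -> I -> S) x f i :
    (fun z => update _ r x f z i) = update S (r^~ i) x (f i).
  by apply/funext => z; rewrite /update; case: Nat.eqb.
have exP r x p :
    (forall r', sat ultrapower (fun z => ultra_class (r' z)) p <->
                U [set i | sat S (r'^~ i) p]) ->
    (exists a, sat ultrapower (update _ (fun z => ultra_class (r z)) x a) p) <->
    U [set i | exists a, sat S (update S (r^~ i) x a) p].
  move=> IH; split=> [[a]|Uex].
    rewrite -(ultra_classK a) updE IH; apply: filterS => i /=.
    by rewrite updE'; exists (sval a i).
  (* Witnesses are chosen index by index; the default [s0] is taken only outside the set of [Uex],
     which belongs to [U]. *)
  pose w i : S := @xget {classic S} s0 [set a | sat S (update S (r^~ i) x a) p].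
  exists (ultra_class w); rewrite updE IH; apply: filterS Uex => i /= [a sa].
  rewrite updE'.
  apply: (@xgetPex {classic S} s0 [set b | sat S (update S (r^~ i) x b) p]).
  by exists a.
elim: phi rho => [x y|x y||p IH|p IHp q IHq|p IHp q IHq|p IHp q IHq|x p IH|x p IH]
  rho /=.
- exact: ultra_class_eq.
- exact: ultra_class_step.
- by split=> // /filter_ex[].
- by rewrite IH -ultra_setC.
- rewrite IHp IHq; split=> [[]|pq]; first exact: filterI.
  by split; apply: filterS pq => i [].
- rewrite IHp IHq; split=> [[]|pq].
  + by apply: filterS => i; left.
  + by apply: filterS => i; right.
  + have [Up|/ultra_setC nUp] := pselect (U [set i | sat S (rho^~ i) p]).
      by left.
    by right; apply: filterS (filterI pq nUp) => i [[]].
- rewrite IHp IHq; split=> [pq|pq Up].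
    have [/pq|/ultra_setC] := pselect (U [set i | sat S (rho^~ i) p]).
      by apply: filterS => i /= qi _.
    by apply: filterS => i np /np.
  by apply: filterS (filterI pq Up) => i [pq' /pq'].
(* The universal quantifier is treated as the dual of the existential one, applied to [FNot p]. *)
- have IHn r' : sat ultrapower (fun z => ultra_class (r' z)) (FNot p) <->
                U [set i | sat S (r'^~ i) (FNot p)].
    by rewrite /= IH -ultra_setC.
  have not_ex (T : Type) (P : T -> Prop) : (forall a, P a) <-> ~ exists a, ~ P a.
    split=> [Pa [a /(_ (Pa a))] // | nex a].
    by apply: contra_notP nex => nPa; exists a.
  rewrite not_ex (exP rho x _ IHn) -ultra_setC.
  split; apply: filterS => i /= h.
    exact: (proj2 (not_ex _ _) h).
  exact: (proj1 (not_ex _ _) h).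
- exact: exP.
Qed.

(** Valuations in [S] lift to constant functions, and every valuation in the ultrapower consists of
    classes, so [los] applies in both directions. *)
Lemma ultrapower_models (Phi : formula -> Prop) :
  models ultrapower Phi <-> models S Phi.
Proof.
split=> mPhi phi /mPhi + rho.
  by move=> /(_ (fun z => ultra_class (fun=> rho z))) /los /filter_ex[].
move=> sphi.
have -> : rho = fun z => ultra_class (sval (rho z)).
  by apply/funext => z; rewrite ultra_classK.
by apply/los; apply: filterS (filterT (F := U)) => i _; exact: sphi.
Qed.

End Ultrapower.

Lemma not_generalised_first_order (P : ARS -> Prop) (S T : ARS) :
  (forall Phi, models T Phi <-> models S Phi) -> P S -> ~ P T ->
  ~ generalised_first_order P /\ ~ generalised_first_order (neg_property P).
Proof.
move=> eqTS PS nPT; split=> -[Phi [_ PhiP]].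
  by apply: nPT; apply/PhiP/eqTS/PhiP.
by have : neg_property P S by apply/PhiP/eqTS/PhiP.
Qed.

(** * The countdown system and its ultrapower *)

Inductive countdown_node : Set := Peak of nat | Count of nat.

(** The boolean is the label: counting steps lie below both steps of a peak, so arbitrarily many of
    them may be used to join it. *)
Inductive countdown_step : bool -> relation countdown_node :=
| peak_zero n : countdown_step true (Peak n) (Count 0)
| peak_count n : countdown_step true (Peak n) (Count n)
| count_pred n : countdown_step false (Count n.+1) (Count n).

Definition countdown : ARS :=
  mkARS countdown_node (fun x y => exists b, countdown_step b x y)
        (inhabits (Count 0)).

(* The two labels needed are the images of [false < true] in [alpha]; the others
   are left empty. *)
Lemma countdown_DCR_ord (alpha : Ord) :
  ord_le ord_two alpha -> DCR_ord alpha countdown.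
Proof.
move=> [f [f_mono _]].
pose R (c : alpha) (x y : countdown) := exists2 b, c = f b & countdown_step b x y.
exists R; split=> [x y|beta gamma a b c].
  split=> [[e xy]|[c [e _ xy]]]; last by exists e.
  by exists (f e), e.
have leg0 n c' : decreasing_leg countdown alpha (ord_rel alpha) R (f true) c'
                   (Count n) (Count 0).
  exists (Count 0), (Count 0); split; last first.
    by split; [exact: r_refl|exact: rt_refl].
  elim: n => [|n IHn]; first exact: rt_refl.
  apply: rt_trans IHn; apply: rt_step; exists (f false).
  by split; [exact: f_mono|exists false => //; exact: count_pred].
have leg_refl c1 c2 x : decreasing_leg countdown alpha (ord_rel alpha) R c1 c2 x x.
  by exists x, x; split; [exact: rt_refl|split; [exact: r_refl|exact: rt_refl]].
move=> [e -> ac] [e' -> ab].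
case: ac ab => [n|n|n] ab; inversion ab; subst; try by exists (Count 0).
(* What remains is a counting step paired with itself. *)
by exists (Count n).
Qed.

Lemma DCR_ord_DCR (alpha : Ord) (S : ARS) : DCR_ord alpha S -> DCR S.
Proof.
move=> dS; exists alpha, (ord_rel alpha).
by split; [exact: ord_strict|split; [exact: ord_wf|]].
Qed.

(** Erasing the labels of a decreasing diagram leaves a local confluence diagram. *)
Lemma DCR_locally_confluent (S : ARS) (a b c : S) :
  DCR S -> step S a b -> step S a c ->
  exists d, clos_refl_trans S (step S) b d /\ clos_refl_trans S (step S) c d.
Proof.
move=> [I [lt [_ [_ [R [stepE dec]]]]]] /stepE[gamma ab] /stepE[beta ac].
have RS e x y : R e x y -> step S x y by move=> xy; apply/stepE; exists e.
have mono (r : relation S) : (forall x y, r x y -> step S x y) ->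
    forall x y, clos_refl_trans S r x y -> clos_refl_trans S (step S) x y.
  move=> rS x y; elim=> {x y} [x y /rS|x|x y z _ xy _ yz].
  - exact: rt_step.
  - exact: rt_refl.
  - exact: rt_trans yz.
have belowS e x y : below S I lt R e x y -> step S x y by move=> [e' [_ /RS]].
have legS g e x y :
    decreasing_leg S I lt R g e x y -> clos_refl_trans S (step S) x y.
  move=> [x1 [x2 [xx1 [x1x2 x2y]]]].
  apply: rt_trans (mono _ (@belowS g) _ _ xx1) _.
  apply: (rt_trans _ _ _ x2).
    case: x1x2 => [z /RS|]; [exact: rt_step|exact: rt_refl].
  by apply: mono x2y => u v [] /belowS.
have [d [bd cd]] := dec _ _ _ _ _ ac ab.
by exists d; split; [exact: legS bd|exact: legS cd].
Qed.

(** The class of [Count 0] is a normal form, so a joining reduction would have to lead from the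
    class of [Count] to it in some fixed number [j] of steps; this fails at all indices above [j], a
    set in [U] because [U] contains every cofinite set. *)
Lemma ultra_countdown_not_DCR (U : set_system nat) (ultraU : UltraFilter U) :
  \oo `<=` U -> ~ DCR (ultrapower ultraU (Count 0 : countdown)).
Proof.
move=> ooU; set B := ultrapower _ _ => dB.
pose cl : (nat -> countdown) -> B := ultra_class ultraU (Count 0 : countdown).
have cl_step f g : (forall n, step countdown (f n) (g n)) ->
    step B (cl f) (cl g).
  move=> fg; apply/ultra_class_step.
  by apply: filterS (filterT (F := U)) => n _; exact: fg.
have [||d [zd cd]] := @DCR_locally_confluent B (cl Peak)
  (cl (fun=> Count 0)) (cl Count) dB.
- by apply: cl_step => n; exists true; exact: peak_zero.
- by apply: cl_step => n; exists true; exact: peak_count.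
have nf0 y : ~ step B (cl (fun=> Count 0)) y.
  rewrite -(ultra_classK y) => /ultra_class_step/filter_ex[n [b /= h]].
  by inversion h.
have {zd} ed : d = cl (fun=> Count 0).
  by have [//|y z /nf0] := clos_rt_rt1n _ _ _ _ zd.
(* Truncated subtraction does no harm: a step leaves [Count (n - j)] only where [n - j] is
   positive. *)
have cdj x : clos_refl_trans_n1 _ (step B) (cl Count) x ->
    exists j, x = cl (fun n => Count (n - j)).
  elim=> [|y z yz _ [j ey]].
    by exists 0; congr cl; apply/funext => n; rewrite subn0.
  exists j.+1; move: yz; rewrite ey -(ultra_classK z) => /ultra_class_step yz.
  apply/ultra_class_eq; apply: filterS yz => n /= [b h].
  by inversion h as [| |m eb em ez]; rewrite subnS -em.
have [j] := cdj _ (clos_rt_rtn1 _ _ _ _ cd).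
rewrite ed => /ultra_class_eq Uj.
have Ugt : U [set n | j < n] by apply: ooU; exists j.+1.
have [n [/= [e] jn]] := filter_ex (filterI Uj Ugt).
by move: jn; rewrite -subn_gt0 -e.
Qed.

Theorem theorem4p5 (alpha : Ord) (alpha_ge2 : ord_le ord_two alpha) :
  ~ generalised_first_order (DCR_ord alpha) /\
  ~ generalised_first_order (neg_property (DCR_ord alpha)) /\
  ~ generalised_first_order DCR /\
  ~ generalised_first_order (neg_property DCR).
Proof.
have [U [ultraU ooU]] := ultraFilterLemma eventually_filter.
have eqU := ultrapower_models ultraU (Count 0 : countdown).
have dcr := countdown_DCR_ord alpha_ge2.
have ndcr := @ultra_countdown_not_DCR U ultraU ooU.
have [] := not_generalised_first_order eqU dcr (fun d => ndcr (DCR_ord_DCR d)).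
by have [] := not_generalised_first_order eqU (DCR_ord_DCR dcr) ndcr.
Qed.
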